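(* (Split Short Five Lemma) Let $(f,u,p):(B,X,A,\alpha,\beta,\kappa,\lambda)\to(B',X',A',\alpha',\beta',\kappa',\lambda')$ be a morphism of split extensions of magmas. If $f$ and $u$ are isomorphisms, then $p$ is an isomorphism.
   Context: A (unitary) magma is a set $M$ with an element $0$ and a binary operation $+$ satisfying $0+x=x=x+0$ for all $x\in M$ (no other axiom). A magma homomorphism is a map preserving $0$ and $+$. Sums of maps are taken pointwise; $1$ denotes identity maps and $0$ also denotes constant zero maps. Split extension of magmas: a seven-tuple $E=(B,X,A,\alpha,\beta,\kappa,\lambda)$ where $B,X,A$ are magmas, $\alpha:A\to B$, $\beta:B\to A$, $\kappa:X\to A$ are magma homomorphisms, $\lambda:A\to X$ is a map with $\lambda(0)=0$ (not necessarily preserving addition), and, for all $x\in X$, $a\in A$, $b\in B$: $\lambda\kappa=1$, $\alpha\beta=1$; $\lambda\beta=0$, $\alpha\kappa=0$; $\kappa\lambda+\beta\alpha=1$; $\lambda(\kappa(x)+\beta(b))=x$; $\kappa(x)+(\beta(b)+a)=(\kappa(x)+\beta(b))+a$; $\kappa(x)+(a+\beta(b))=(\kappa(x)+a)+\beta(b)$; $a+(\kappa(x)+\beta(b))=(a+\kappa(x))+\beta(b)$. A morphism $(B,X,A,\alpha,\beta,\kappa,\lambda)\to(B',X',A',\alpha',\beta',\kappa',\lambda')$ of split extensions is a triple $(f,u,p)$ of magma homomorphisms $f:B\to B'$, $u:X\to X'$, $p:A\to A'$ with $p\kappa=\kappa'u$, $p\beta=\beta'f$, $\lambda'p=u\lambda$,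 $\alpha'p=f\alpha$. *)

(* Defs.v *)
From HB Require Import structures.
From mathcomp Require Import all_boot all_algebra.

Set Implicit Arguments.
Unset Strict Implicit.
Unset Printing Implicit Defensive.

Import GRing.Theory.
Local Open Scope ring_scope.

(* [umagmaType] and [addUMagmaType] both carry a choice structure, and the    *)
(* latter is moreover commutative, so unitary magmas are built here directly  *)
(* on the bare signature (0, +).  Magma homomorphisms are then the library's  *)
(* [{additive M -> N}], i.e. maps preserving 0 and +.                         *)
HB.mixin Record isUnitaryMagma M of Algebra.BaseAddUMagma M := {
  magma_add0r : left_id 0 (@GRing.add M);
  magma_addr0 : right_id 0 (@GRing.add M)
}.

#[short(type="unitaryMagmaType")]
HB.structure Definition UnitaryMagma :=
  {M of isUnitaryMagma M & Algebra.BaseAddUMagma M}.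

Bind Scope ring_scope with UnitaryMagma.sort.

Definition magma_iso (M N : unitaryMagmaType) (h : {additive M -> N}) : Prop :=
  exists g : {additive N -> M}, cancel h g /\ cancel g h.

Record split_extension := SplitExtension {
  sB : unitaryMagmaType;
  sX : unitaryMagmaType;
  sA : unitaryMagmaType;
  alpha : {additive sA -> sB};
  beta : {additive sB -> sA};
  kappa : {additive sX -> sA};
  lambda : sA -> sX;
  lambda0 : lambda 0 = 0;
  lambda_kappa : forall x, lambda (kappa x) = x;
  alpha_beta : forall b, alpha (beta b) = b;
  lambda_beta : forall b, lambda (beta b) = 0;
  alpha_kappa : forall x, alpha (kappa x) = 0;
  kappa_lambda_beta_alpha : forall a, kappa (lambda a) + beta (alpha a) = a;
  lambda_kappaD_beta : forall x b, lambda (kappa x + beta b) = x;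
  kappa_beta_addA : forall x b a,
    kappa x + (beta b + a) = (kappa x + beta b) + a;
  kappa_add_betaA : forall x a b,
    kappa x + (a + beta b) = (kappa x + a) + beta b;
  add_kappa_betaA : forall a x b,
    a + (kappa x + beta b) = (a + kappa x) + beta b
}.

Arguments alpha : clear implicits.
Arguments beta : clear implicits.
Arguments kappa : clear implicits.
Arguments lambda : clear implicits.

Record split_extension_morphism (E E' : split_extension)
    (f : {additive sB E -> sB E'})
    (u : {additive sX E -> sX E'}) (p : {additive sA E -> sA E'}) : Prop := {
  morphism_kappa : forall x, p (kappa E x) = kappa E' (u x);
  morphism_beta : forall b, p (beta E b) = beta E' (f b);
  morphism_lambda : forall a, lambda E' (p a) = u (lambda E a);
  morphism_alpha : forall a, alpha E' (p a) = f (alpha E a)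
}.

Arguments split_extension_morphism : clear implicits.

(* Main.v *)
Require Import Defs.
From HB Require Import structures.
From mathcomp Require Import all_boot all_algebra.

(** Each element is recovered from its two components by
    [a = kappa (lambda a) + beta (alpha a)], and a morphism of split extensions
    acts on these components separately, through [u] and [f].  Applying the
    inverses of [u] and [f] to the components and reassembling the result gives
    the map [split_inverse].  It undoes [p] on the left because
    [lambda' p = u lambda] and [alpha' p = f alpha], and on the right because
    [p] is additive with [p kappa = kappa' u] and [p beta = beta' f]; in both
    cases the composite reduces to the decomposition above.  Additivity of the
    inverse is not visible from its formula, since [lambda] need not be additive:
    it is inherited from [p], as for the inverse of any bijective homomorphism
    ([bijective_magma_iso]). *)

Set Implicit Arguments.
Unset Strict Implicit.
Unset Printing Implicit Defensive.

Import GRing.Theory.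
Local Open Scope ring_scope.

(** Injectivity of [h] suffices to transport additivity to its inverse [g]: both
    [g (x + y)] and [g x + g y] are mapped by [h] to [x + y]. *)
Lemma bijective_magma_iso (M N : unitaryMagmaType) (h : {additive M -> N})
    (g : N -> M) :
  cancel h g -> cancel g h -> magma_iso h.
Proof.
move=> hK gK.
have g_additive : nmod_morphism g.
  split=> [|x y]; apply: (can_inj hK); first by rewrite gK raddf0.
  by rewrite raddfD !gK.
pose gM := GRing.isNmodMorphism.Build N M g g_additive.
pose ga : {additive N -> M} := HB.pack g gM.
by exists ga.
Qed.

Definition split_inverse (E E' : split_extension) (f' : sB E' -> sB E)
    (u' : sX E' -> sX E) (a : sA E') : sA E :=
  kappa E (u' (lambda E' a)) + beta E (f' (alpha E' a)).

Theorem mainTheorem7 (E E' : split_extension)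
    (f : {additive sB E -> sB E'}) (u : {additive sX E -> sX E'})
    (p : {additive sA E -> sA E'}) :
  split_extension_morphism E E' f u p ->
  magma_iso f -> magma_iso u -> magma_iso p.
Proof.
move=> [p_kappa p_beta p_lambda p_alpha] [f' [fK f'K]] [u' [uK u'K]].
apply: (@bijective_magma_iso _ _ p (split_inverse f' u')) => a.
  by rewrite /split_inverse p_lambda p_alpha uK fK kappa_lambda_beta_alpha.
by rewrite raddfD p_kappa p_beta u'K f'K kappa_lambda_beta_alpha.
Qed.
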